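(* Let $L=\begin{bmatrix} A & B \\ C & D \end{bmatrix}\in\mathbb{C}^{N\times N}$ be invertible with $A\in\mathbb{C}^{(N-n)\times(N-n)}$ and $D\in\mathbb{C}^{n\times n}$ invertible, $1\le n\le N-1$, let $m\ge1$, and suppose that $T:=A^{-1}BD^{-1}C$ is diagonalizable. Let $M^{-1}$ be the matrix of the two-level V-cycle (defined in the context) with parameters $\hat\alpha_i=\frac{1}{1-\cos(2\pi i/(2m+1))}$, $i=1,\dots,m$, and let $\hat\rho_m:=1-\frac{1}{(2m+1)^2}$. Then the minimal polynomial of $M^{-1}L$ is $(t-1)(t-\hat\rho_m)$; in particular $$(M^{-1}L-I)(M^{-1}L-\hat\rho_m I)=0,$$ and $$L^{-1}=\left(\left(1+\frac{1}{\hat\rho_m}\right)I-\frac{1}{\hat\rho_m}M^{-1}L\right)M^{-1}.$$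
   Context: Put $$P=\begin{bmatrix} -A^{-1}B \\ I \end{bmatrix},\quad R=\begin{bmatrix} -CA^{-1} & I \end{bmatrix},\quad S^{-1}=\begin{bmatrix} A^{-1} & 0 \\ 0 & D^{-1} \end{bmatrix},\quad M_0=RLP=D-CA^{-1}B$$ ($M_0$ is invertible because $L$ and $A$ are). The two-level V-cycle with parameters $\alpha_1,\dots,\alpha_m$ maps $\mathbf v\in\mathbb{C}^N$ to the vector $\mathbf x=M^{-1}\mathbf v$ obtained by starting from $\mathbf x=0$, performing $\mathbf x\leftarrow\mathbf x+\alpha_iS^{-1}(\mathbf v-L\mathbf x)$ for $i=1,\dots,m$, then $\mathbf x\leftarrow\mathbf x+PM_0^{-1}R(\mathbf v-L\mathbf x)$, then $\mathbf x\leftarrow\mathbf x+\alpha_iS^{-1}(\mathbf v-L\mathbf x)$ for $i=m,\dots,1$. This defines the matrix $M^{-1}$. Equivalently $M^{-1}L=I-E$ with $$E=\Big(\prod_{i=1}^m(I-\alpha_iS^{-1}L)\Big)(I-PM_0^{-1}RL)\Big(\prod_{i=1}^m(I-\alpha_iS^{-1}L)\Big).$$ *)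

(* Defs.v *)
From HB Require Import structures.
From mathcomp Require Import all_boot all_order all_algebra.
From mathcomp Require Import complex.
From mathcomp Require Import all_classical all_reals all_analysis.

Set Implicit Arguments.
Unset Strict Implicit.
Unset Printing Implicit Defensive.

Import Order.TTheory GRing.Theory Num.Theory.
Local Open Scope ring_scope.

Section TwoLevelVCycle.
Variables (F : fieldType) (p n : nat).
Variables (A : 'M[F]_p) (B : 'M[F]_(p, n)) (C : 'M[F]_(n, p)) (D : 'M[F]_n).

Definition sysmx : 'M[F]_(p + n) := block_mx A B C D.

Definition prolongmx : 'M[F]_(p + n, n) := col_mx (- (invmx A *m B)) 1%:M.

Definition restrmx : 'M[F]_(n, p + n) := row_mx (- (C *m invmx A)) 1%:M.

(* This is the matrix S^-1, not S. *)
Definition smoothinv : 'M[F]_(p + n) := block_mx (invmx A) 0 0 (invmx D).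

Definition coarsemx : 'M[F]_n := restrmx *m sysmx *m prolongmx.

Lemma coarsemxE : A \in unitmx -> coarsemx = D - C *m invmx A *m B.
Proof.
move=> uA; rewrite /coarsemx /restrmx /sysmx /prolongmx mul_row_block.
rewrite mul_row_col !mulNmx !mul1mx mulmxKV // addNr mul0mx add0r mulmx1.
by rewrite addrC.
Qed.

Definition smooth_step (v x : 'cV[F]_(p + n)) (a : F) : 'cV[F]_(p + n) :=
  x + a *: (smoothinv *m (v - sysmx *m x)).

Definition coarse_step (v x : 'cV[F]_(p + n)) : 'cV[F]_(p + n) :=
  x + prolongmx *m invmx coarsemx *m restrmx *m (v - sysmx *m x).

Definition vcycle (alpha : seq F) (v : 'cV[F]_(p + n)) : 'cV[F]_(p + n) :=
  foldl (smooth_step v)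
    (coarse_step v (foldl (smooth_step v) 0 alpha)) (rev alpha).

(* The matrix M^-1: its j-th column is the image of the j-th basis vector.
   That it represents vcycle is vcyclemxE below. *)
Definition vcyclemx (alpha : seq F) : 'M[F]_(p + n) :=
  \matrix_(i, j) vcycle alpha (delta_mx j 0) i 0.

Let affine (f : 'cV[F]_(p + n) -> 'cV[F]_(p + n)) :=
  exists K, forall v, f v = K *m v.

Let affine_smooth f a : affine f -> affine (fun v => smooth_step v (f v) a).
Proof.
case=> K fE; exists (K + a *: (smoothinv *m (1%:M - sysmx *m K))) => v.
rewrite /smooth_step fE mulmxDl -scalemxAl -!mulmxA mulmxBl mul1mx.
by rewrite !mulmxA.
Qed.

Let affine_foldl s f : affine f -> affine (fun v => foldl (smooth_step v) (f v) s).
Proof. by elim: s f => //= a s IH f /affine_smooth-/(_ a) /IH. Qed.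

Let affine_vcycle alpha : affine (vcycle alpha).
Proof.
apply: affine_foldl.
have [|K fE] := @affine_foldl alpha (fun=> 0).
  by exists 0 => v; rewrite mul0mx.
pose G := prolongmx *m invmx coarsemx *m restrmx.
exists (K + G *m (1%:M - sysmx *m K)) => v.
by rewrite /coarse_step fE mulmxDl -(mulmxA G) mulmxBl mul1mx !mulmxA.
Qed.

Lemma vcyclemxE alpha v : vcyclemx alpha *m v = vcycle alpha v.
Proof.
have [K fE] := affine_vcycle alpha.
rewrite fE; congr (_ *m v); apply/matrixP => i j.
by rewrite mxE fE -colE mxE.
Qed.

End TwoLevelVCycle.

Section OptimalWeights.
Variable R : realType.

Definition alpha_opt (m i : nat) : R :=
  (1 - cos (2 * pi * i%:R / (2 * m + 1)%N%:R))^-1.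

Definition alphas_opt (m : nat) : seq R := [seq alpha_opt m i | i <- iota 1 m].

Definition rho_opt (m : nat) : R := 1 - ((2 * m + 1)%N%:R ^+ 2)^-1.

End OptimalWeights.

(* Main.v *)
Require Import Defs.
From HB Require Import structures.
From mathcomp Require Import all_boot all_order all_algebra.
From mathcomp Require Import complex.
From mathcomp Require Import all_classical all_reals all_analysis.
From mathcomp Require Import ring lra zify.

Set Implicit Arguments.
Unset Strict Implicit.
Unset Printing Implicit Defensive.

Import Order.TTheory GRing.Theory Num.Theory.
Local Open Scope ring_scope.
Local Open Scope complex_scope.

(** Write K = S^-1 L, which has identity diagonal blocks, let N = diag(I, 0) be
the projection onto the block of A, and let q be the smoothing polynomial, the
product of the factors 1 - alpha_i t.  The coarse correction replaces the error
by N K times the error, so the whole cycle has the error matrix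
E = q(K) N K q(K) and M^-1 L = I - E ([vcycle_error]).

The spectrum of E is governed by the compression N (K q(K)^2) N.  Conjugation by
J = diag(I, -I) sends K to 2 - K and does not change such a compression, which
is therefore N g(K) N with g(t) the average of t q(t)^2 and (2 - t) q(2 - t)^2.
The weights make g constant: the roots 1 - cos(2 pi i / (2m+1)) of q are the
roots of the polynomial a_m defined by
  sin((2m+1) psi) = sin psi * a_m(1 - cos(2 psi)),
and a_m(0) = 2m+1, so that q = a_m / (2m+1) ([smoothing_polynomial]).  For
t = 1 - cos(2 psi) one has t a_m(t)^2 = 2 sin^2((2m+1) psi), while replacing t
by 2 - t turns the sine into a cosine; hence
  t a_m(t)^2 + (2 - t) a_m(2 - t)^2 = 2
([oddangle_pair_sum]), and g = 1/(2m+1)^2 =: c.  Thus N K q(K)^2 N = c N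
([coarse_smooth_compress]), and E^2 = c E follows from the factorization of E.

This is the quadratic equation of W = M^-1 L with roots 1 and rho = 1 - c.  It
is minimal because W is not scalar: a scalar E would vanish, since det N = 0,
whereas N K q(K) E q(K) N = c^2 N is nonzero ([two_level_minpoly]).  Finally
the quadratic equation, with its nonzero constant term rho, gives the left
inverse of L. *)

(** * Odd multiple-angle polynomials *)

(** [oddangle x k] is the pair (a_k, b_k) with
sin((2k+1) psi) = sin psi * a_k and cos((2k+1) psi) = cos psi * b_k for
x = 1 - cos(2 psi); the step is rotation by 2 psi.  An arbitrary ring is allowed
so that the same recursion yields numbers, polynomials (x = 'X) and matrix
functions. *)
Fixpoint oddangle (S : pzRingType) (x : S) (k : nat) : S * S :=
  if k is k'.+1 then
    let: (a, b) := oddangle x k' in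
    ((1 - x) * a + (2 - x) * b, (1 - x) * b - x * a)
  else (1, 1).

Lemma oddangleS (S : pzRingType) (x : S) (k : nat) :
  oddangle x k.+1 =
    ((1 - x) * (oddangle x k).1 + (2 - x) * (oddangle x k).2,
     (1 - x) * (oddangle x k).2 - x * (oddangle x k).1).
Proof. by rewrite /=; case: (oddangle x k). Qed.

Lemma rmorph_oddangle (S S' : pzRingType) (f : {rmorphism S -> S'}) (x : S) k :
  oddangle (f x) k = (f (oddangle x k).1, f (oddangle x k).2).
Proof.
elim: k => [|k IH]; first by rewrite /= rmorph1.
by rewrite !oddangleS IH /= !(rmorphB, rmorphD, rmorphM, rmorph1, rmorph_nat).
Qed.

Lemma oddangle_trig (R : realType) (psi : R) k :
  let x := 1 - cos (psi + psi) in
  sin (psi *+ k.*2.+1) = sin psi * (oddangle x k).1 /\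
  cos (psi *+ k.*2.+1) = cos psi * (oddangle x k).2.
Proof.
move=> x; elim: k => [|k [IHs IHc]]; first by rewrite /= !mulr1 mulr1n.
have -> : psi *+ k.+1.*2.+1 = psi *+ k.*2.+1 + (psi + psi).
  by rewrite doubleS -[X in _ *+ X]addn2 mulrnDr mulr2n.
have cs : cos psi * cos psi = 1 - sin psi * sin psi.
  by rewrite -!expr2 -(cos2Dsin2 psi) addrK.
have c2 : cos (psi + psi) = 1 - 2 * (sin psi * sin psi).
  by rewrite cosD cs; ring.
have s2 : sin (psi + psi) = 2 * (sin psi * cos psi) by rewrite sinD; ring.
rewrite oddangleS (sinD (psi *+ _)) (cosD (psi *+ _)) IHs IHc s2 /x c2.
move: (oddangle _ k) => [a b] /=.
move: (cos psi) (sin psi) cs => c s cs; split; last by ring.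
transitivity (s * a * (1 - 2 * (s * s)) + 2 * s * b * (c * c)); first by ring.
by rewrite cs; ring.
Qed.

(** The identity sin^2 + cos^2 = 1 at the angle (2k+1) psi, doubled: x is
2 sin^2 psi and 2 - x is 2 cos^2 psi. *)
Lemma oddangle_pythagoras (S : comPzRingType) (x : S) k :
  x * (oddangle x k).1 ^+ 2 + (2 - x) * (oddangle x k).2 ^+ 2 = 2.
Proof.
elim: k => [|k IH]; first by rewrite /=; ring.
by rewrite oddangleS -[RHS]IH /=; ring.
Qed.

(** Replacing x by 2 - x amounts to replacing psi by pi/2 - psi, which exchanges
sine and cosine up to the sign of sin((2k+1) pi/2). *)
Lemma oddangle_reflect (S : comPzRingType) (x : S) k :
  oddangle (2 - x) k =
    ((-1) ^+ k * (oddangle x k).2, (-1) ^+ k * (oddangle x k).1).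
Proof.
elim: k => [|k IH]; first by rewrite /= expr0 mul1r.
by rewrite !oddangleS IH exprS /=; apply: congr2; ring.
Qed.

Lemma oddangle_pair_sum (S : comPzRingType) (x : S) k :
  x * (oddangle x k).1 ^+ 2 + (2 - x) * (oddangle (2 - x) k).1 ^+ 2 = 2.
Proof.
by rewrite oddangle_reflect /= exprMn sqrr_sign mul1r oddangle_pythagoras.
Qed.

Lemma oddangle_intertwine (S : pzRingType) (x y J : S) k :
    J * x = y * J ->
  J * (oddangle x k).1 = (oddangle y k).1 * J /\
  J * (oddangle x k).2 = (oddangle y k).2 * J.
Proof.
move=> Jx.
have J1 : J * (1 - x) = (1 - y) * J by rewrite mulrBr mulrBl Jx mulr1 mul1r.
have J2 : J * (2 - x) = (2 - y) * J.
  by rewrite mulrBr mulrBl Jx mulr_natl mulr_natr.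
elim: k => [|k [IH1 IH2]]; first by rewrite /= mulr1 mul1r.
rewrite !oddangleS /=; split.
  by rewrite mulrDr [RHS]mulrDl !mulrA J1 J2 -!mulrA IH1 IH2.
by rewrite mulrBr [RHS]mulrBl !mulrA J1 Jx -!mulrA IH1 IH2.
Qed.

(** The hypotheses say that J conjugates x into 2 - x and is absorbed on both
sides by the projection N.  Compressing to N thus cannot distinguish
x a(x)^2 from (2 - x) a(2 - x)^2, and these two sum to 2. *)
Lemma oddangle_compress (F : fieldType) (S : algType F) (x J N : S) k :
    (2 : F) != 0 -> J * x = (2 - x) * J -> J * N = N -> N * J = N -> N * N = N ->
  N * (x * (oddangle x k).1 ^+ 2) * N = N.
Proof.
move=> nz2 Jx JN NJ NN.
have [Ja _] := oddangle_intertwine k Jx.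
have JxaN : N * (x * (oddangle x k).1 ^+ 2) * N =
    N * ((2 - x) * (oddangle (2 - x) k).1 ^+ 2) * N.
  have Jxa : J * (x * (oddangle x k).1 ^+ 2) =
      (2 - x) * (oddangle (2 - x) k).1 ^+ 2 * J.
    by rewrite !expr2 !mulrA Jx -(mulrA _ J) Ja mulrA -(mulrA _ J) Ja !mulrA.
  by rewrite -{1}NJ -(mulrA N J) Jxa mulrA -(mulrA _ J) JN.
(* The pair-sum identity needs a commutative ring: it is proved in {poly F} and
   evaluated at x. *)
have pair_sum : x * (oddangle x k).1 ^+ 2
    + (2 - x) * (oddangle (2 - x) k).1 ^+ 2 = 2.
  have := congr1 (horner_alg x) (oddangle_pair_sum ('X : {poly F}) k).
  rewrite !expr2 rmorphD !rmorphM /= rmorphB !rmorph_nat /=.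
  have -> : horner_alg x (oddangle ('X : {poly F}) k).1 = (oddangle x k).1.
    by rewrite -{2}(horner_algX x) rmorph_oddangle.
  have -> : horner_alg x (oddangle (2 - 'X : {poly F}) k).1
      = (oddangle (2 - x) k).1.
    have -> : 2 - x = horner_alg x (2 - 'X).
      by rewrite rmorphB rmorph_nat /= horner_algX.
    by rewrite rmorph_oddangle.
  by rewrite horner_algX.
apply: (scalerI nz2); rewrite scaler_nat mulr2n {2}JxaN.
rewrite -mulrDl -mulrDr pair_sum mulr_natr mulrnAl NN.
by rewrite scaler_nat.
Qed.

Lemma size_oddangle (F : idomainType) k :
  (size (oddangle ('X : {poly F}) k).1 <= k.+1)%N /\
  (size (oddangle ('X : {poly F}) k).2 <= k.+1)%N.
Proof.
elim: k => [|k [IH1 IH2]]; first by rewrite /= size_poly1.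
have sz (l q : {poly F}) :
    (size l <= 2 -> size q <= k.+1 -> size (l * q)%R <= k.+2)%N.
  by move=> szl szq; apply: leq_trans (size_polyMleq _ _) _; lia.
have szB (c : F) : (size (c%:P - 'X)%R <= 2)%N.
  by rewrite -opprB size_polyN size_XsubC.
have sz2 : (size (2 - 'X : {poly F})%R <= 2)%N.
  by have := szB 2; rewrite polyC_natr.
have szX : (size ('X : {poly F}) <= 2)%N by rewrite size_polyX.
rewrite !oddangleS /=; split; apply: leq_trans (size_polyD _ _) _.
  by rewrite geq_max !sz // (szB 1).
by rewrite geq_max size_polyN !sz // (szB 1).
Qed.

Lemma oddangle_at0 (S : pzRingType) k : oddangle (0 : S) k = (k.*2.+1%:R, 1).
Proof.
elim: k => // k IH; rewrite oddangleS IH /= !subr0 mul0r subr0 !mul1r mulr1.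
by rewrite -natrD doubleS addn2.
Qed.

Lemma horner_oddangle (F : comNzRingType) (x : F) k :
  (oddangle ('X : {poly F}) k).1.[x] = (oddangle x k).1.
Proof. by rewrite -!horner_evalE -{2}(hornerX x) -horner_evalE rmorph_oddangle. Qed.

(** The two sides agree at 0 and at all the inverses a^-1, which is one point
more than their degree allows. *)
Lemma poly_prod_inv_roots (F : fieldType) (p : {poly F}) (s : seq F) :
    (size p <= (size s).+1)%N -> uniq s -> 0 \notin s ->
    {in s, forall a, root p a^-1} ->
  p = p.[0] *: \prod_(a <- s) (1 - a *: 'X).
Proof.
move=> szp us s0 rp; apply/eqP; rewrite -subr_eq0; apply/negPn/negP => dn0.
set q := \prod_(a <- s) _ in dn0.
have szq : (size q <= (size s).+1)%N.
  rewrite /q; elim: s {us s0 rp szp dn0 q} => [|a s IH].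
    by rewrite big_nil size_poly1.
  rewrite big_cons; apply: leq_trans (size_polyMleq _ _) _.
  have : (size (1 - a *: 'X : {poly F})%R <= 2)%N.
    apply: leq_trans (size_polyD _ _) _; rewrite geq_max size_poly1 size_polyN /=.
    by apply: leq_trans (size_scale_leq _ _) _; rewrite size_polyX.
  by move=> szl; move: (leq_add szl IH); rewrite /= !add2n; case: (_ + _)%N.
suff : (size (0%R :: [seq a^-1 | a <- s]) < (size s).+1)%N.
  by rewrite /= size_map ltnn.
have rts : all (root (p - p.[0] *: q)) (0%R :: [seq a^-1 | a <- s]).
  rewrite /=; apply/andP; split.
    rewrite rootE !hornerE horner_prod big1_seq ?mulr1 ?subrr // => a _.
    by rewrite !hornerE ?mulr0 subr0.
  apply/allP => _ /mapP [a sa ->]; rewrite rootE !hornerE.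
  rewrite (eqP (rp a sa)) horner_prod (big_rem a) //= !hornerE.
  have a0 : a != 0 by apply: contraNneq s0 => <-.
  by rewrite divff // subrr /= mulr0 mul0r oppr0.
have urts : uniq (0%R :: [seq a^-1 | a <- s]).
  rewrite /= map_inj_uniq ?us ?andbT; last exact: invr_inj.
  by apply: contra s0 => /mapP [a sa /esym/eqP]; rewrite invr_eq0 => /eqP <-.
apply: leq_trans (max_poly_roots dn0 rts urts) _.
apply: leq_trans (size_polyD _ _) _; rewrite geq_max size_polyN.
by rewrite szp (leq_trans (size_scale_leq _ _)).
Qed.

(** * Error matrix of the two-level cycle *)

Section TwoLevel.
Variables (F : fieldType) (p n : nat).
Variables (A : 'M[F]_p.+1) (B : 'M[F]_(p.+1, n.+1)).
Variables (C : 'M[F]_(n.+1, p.+1)) (D : 'M[F]_n.+1).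

Let L := sysmx A B C D.
Let K := smoothinv A D *m L.
Let N : 'M[F]_(p.+1 + n.+1) := block_mx 1%:M 0 0 0.
Let smoothpoly (s : seq F) : {poly F} := \prod_(a <- s) (1 - a *: 'X).

(** The coarse matrix is the Schur complement of A in L, so
det L = det A * det M0. *)
Lemma coarsemx_unit : A \in unitmx -> L \in unitmx -> coarsemx A B C D \in unitmx.
Proof.
move=> uA; rewrite coarsemxE // !unitmxE /L /sysmx => uL.
have : \det (block_mx A B C D *m block_mx 1%:M (- (invmx A *m B)) 0 1%:M)
    = \det A * \det (D - C *m invmx A *m B).
  rewrite mulmx_block !mulmx1 !mulmx0 !addr0 mulmxN mulmxA mulmxV // mul1mx addNr.
  by rewrite det_lblock mulmxN mulmxA addrC.
rewrite det_mulmx det_ublock !det1 !mulr1 => detL.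
by move: uL; rewrite detL unitrM => /andP [].
Qed.

Lemma smooth_error (s : seq F) (u x : 'cV[F]_(p.+1 + n.+1)) :
  u - foldl (smooth_step A B C D (L *m u)) x s
    = horner_mx K (smoothpoly s) *m (u - x).
Proof.
elim: s x => [|a s IH] x /=; first by rewrite /smoothpoly big_nil rmorph1 mul1mx.
rewrite IH /smoothpoly big_cons mulrC rmorphM /= -mulmxE -mulmxA.
congr (_ *m _); rewrite /smooth_step rmorphB rmorph1 /= linearZ /= horner_mx_X.
rewrite mulmxBl mul1mx -scalemxAl -mulmxBr /K !mulmxA.
by rewrite opprD addrA.
Qed.

(** R L = [0 M0], so the correction P M0^-1 R L is [0 -A^-1 B; 0 I], and what it
leaves of the identity is the first block row of K. *)
Lemma coarse_error (u x : 'cV[F]_(p.+1 + n.+1)) : A \in unitmx -> D \in unitmx ->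
    L \in unitmx ->
  u - coarse_step A B C D (L *m u) x = N *m K *m (u - x).
Proof.
move=> uA uD uL; have uM := coarsemx_unit uA uL.
have RL : restrmx A C *m L = row_mx 0 (coarsemx A B C D).
  rewrite coarsemxE // /restrmx /L /sysmx mul_row_block !mul1mx !mulNmx mulmxKV //.
  by rewrite addNr addrC.
have NK : N *m K =
    1%:M - prolongmx A B *m invmx (coarsemx A B C D) *m restrmx A C *m L.
  rewrite -mulmxA RL -mulmxA mul_mx_row mulmx0 mulVmx //.
  rewrite /prolongmx mul_col_row !mulmx0 !mulmx1 /K /L /sysmx /smoothinv /N.
  rewrite !mulmx_block !mul1mx !mul0mx !addr0 mulVmx //.
  rewrite scalar_mx_block opp_block_mx add_block_mx.
  by rewrite !oppr0 !addr0 opprK !add0r subrr.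
by rewrite NK mulmxBl mul1mx /coarse_step -mulmxBr !mulmxA opprD addrA.
Qed.

Lemma vcycle_error (s : seq F) : A \in unitmx -> D \in unitmx -> L \in unitmx ->
  vcyclemx A B C D s *m L = 1%:M -
     horner_mx K (smoothpoly s) *m N *m K *m horner_mx K (smoothpoly s).
Proof.
move=> uA uD uL; pose q : 'M[F]_(p.+1 + n.+1) := horner_mx K (smoothpoly s).
rewrite -/q.
(* The cycle is only known through its action on vectors, so the two matrices
   are compared column by column. *)
suff actE (u : 'cV_(p.+1 + n.+1)) :
    vcyclemx A B C D s *m L *m u
      = (1%:M - q *m N *m K *m q) *m u.
  by apply: trmx_inj; apply/row_matrixP => j; rewrite -!tr_col !colE actE.
rewrite -(mulmxA (vcyclemx A B C D s)) vcyclemxE mulmxBl mul1mx; apply/eqP.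
rewrite eq_sym subr_eq addrC -subr_eq eq_sym; apply/eqP.
rewrite /vcycle smooth_error (coarse_error _ _ uA uD uL) smooth_error subr0.
by rewrite /smoothpoly -big_rev /= revK -/(smoothpoly s) -/q !mulmxA.
Qed.

(** The off-diagonal part of K anticommutes with J = diag(I, -I), which is what
[oddangle_compress] asks for. *)
Lemma coarse_smooth_compress (s : seq F) (c : F) k :
    (2 : F) != 0 -> A \in unitmx -> D \in unitmx ->
    (oddangle ('X : {poly F}) k).1 = c *: smoothpoly s -> c != 0 ->
  N *m K *m horner_mx K (smoothpoly s) *m horner_mx K (smoothpoly s) *m N
    = (c ^+ 2)^-1 *: N.
Proof.
move=> nz2 uA uD qE c0; set q := horner_mx K _.
pose J : 'M[F]_(p.+1 + n.+1) := block_mx 1%:M 0 0 (- 1%:M).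
have KE : K = block_mx 1%:M (invmx A *m B) (invmx D *m C) 1%:M.
  rewrite /K /L /sysmx /smoothinv mulmx_block !mul0mx !addr0 !add0r.
  by rewrite !mulVmx.
have JK : J *m K = (2 - K) *m J.
  have -> : 2 - K = block_mx 1%:M (- (invmx A *m B)) (- (invmx D *m C)) 1%:M.
    rewrite KE mulr2n -[1]/(1%:M) scalar_mx_block !add_block_mx opp_block_mx.
    by rewrite add_block_mx !addr0 !add0r !addrK.
  rewrite KE /J !mulmx_block !mul1mx !mulmx1 !mul0mx !mulmx0 !addr0 !add0r.
  by rewrite !mulmxN !mulNmx !mulmx1 !mul1mx opprK.
have JN : J *m N = N.
  by rewrite mulmx_block !(mul1mx, mul0mx, mulmx0, addr0).
have NJ : N *m J = N.
  by rewrite mulmx_block !(mul1mx, mul0mx, mulmx0, addr0).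
have NN : N *m N = N.
  by rewrite mulmx_block !(mul1mx, mul0mx, mulmx0, addr0).
have oK : (oddangle (K : 'M[F]_(p.+1 + n.+1)) k).1 = c *: q.
  by rewrite -{1}(horner_mx_X K) rmorph_oddangle /= qE linearZ.
have := @oddangle_compress F 'M[F]_(p.+1 + n.+1) K J N k nz2 JK JN NJ NN.
rewrite oK expr2 -!(scalerAl, scalerAr) !scalerA -expr2 => H.
by rewrite -[in RHS]H scalerA mulVf ?expf_neq0 // scale1r -!mulmxE !mulmxA.
Qed.

(** The last conjunct holds because E is singular like N, hence could only be the
zero scalar, while c^-4 N, obtained from E by multiplication on both sides, is
nonzero. *)
Lemma two_level_minpoly (s : seq F) (c : F) k :
    (2 : F) != 0 -> A \in unitmx -> D \in unitmx -> L \in unitmx ->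
    (oddangle ('X : {poly F}) k).1 = c *: smoothpoly s -> c != 0 ->
  let W := vcyclemx A B C D s *m L in
  let rho := 1 - (c ^+ 2)^-1 in
  (W - 1%:M) *m (W - rho%:M) = 0 /\ ~~ is_scalar_mx W.
Proof.
move=> nz2 uA uD uL qE c0 W rho.
pose q : 'M[F]_(p.+1 + n.+1) := horner_mx K (smoothpoly s).
pose E := q *m N *m K *m q.
have WE : W = 1%:M - E by exact: vcycle_error.
have NKN : N *m K *m q *m q *m N = (c ^+ 2)^-1 *: N.
  exact: coarse_smooth_compress qE c0.
have EE : E *m E = (c ^+ 2)^-1 *: E.
  transitivity (q *m (N *m K *m q *m q *m N) *m K *m q); first by rewrite /E !mulmxA.
  by rewrite NKN -scalemxAr -!scalemxAl.
have EN : N *m K *m q *m E *m q *m N = (c ^+ 4)^-1 *: N.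
  transitivity ((N *m K *m q *m q *m N) *m K *m q *m q *m N).
    by rewrite /E !mulmxA.
  by rewrite NKN -!scalemxAl NKN scalerA -invfM -exprD.
split.
  have -> : rho%:M = 1%:M - ((c ^+ 2)^-1)%:M :> 'M[F]_(p.+1 + n.+1).
    by rewrite /rho raddfB.
  rewrite WE addrAC subrr add0r opprB [1%:M - E + _]addrC addrA subrK.
  by rewrite mulNmx mulmxDr mulmxN EE mul_mx_scalar subrr oppr0.
apply/negP => /is_scalar_mxP [w Ww].
have Ee : E = (1 - w)%:M by rewrite raddfB /= -Ww WE subKr.
have : \det E = 0.
  by rewrite /E !det_mulmx det_ublock det1 mul1r det0 ?mulr0 ?mul0r.
rewrite Ee det_scalar => /eqP; rewrite expf_eq0 => /andP [_ /eqP w0].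
move: EN; rewrite Ee w0 raddf0 mulmx0 !mul0mx.
move=> /matrixP /(_ (lshift _ 0) (lshift _ 0)).
rewrite mxE mxE block_mxEul mxE eqxx mulr1 => /esym/eqP.
by rewrite invr_eq0 expf_eq0 (negPf c0).
Qed.
End TwoLevel.

(** * Matrices with a quadratic minimal polynomial *)

Lemma mxminpoly_quadratic (F : fieldType) (n : nat) (W : 'M[F]_n.+1) (a b : F) :
    (W - a%:M) *m (W - b%:M) = 0 -> ~~ is_scalar_mx W ->
  mxminpoly W = ('X - a%:P) * ('X - b%:P).
Proof.
move=> W0 Wns; apply/eqP; rewrite -eqp_monic ?mxminpoly_monic //; last first.
  by rewrite monicMl monicXsubC.
have Wdvd : mxminpoly W %| ('X - a%:P) * ('X - b%:P).
  apply: mxminpoly_min.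
  by rewrite rmorphM !rmorphB /= !horner_mx_X !horner_mx_C.
rewrite -(dvdp_size_eqp Wdvd) eqn_leq dvdp_leq //=; last first.
  by rewrite mulf_neq0 ?polyXsubC_eq0.
rewrite size_mul ?polyXsubC_eq0 // !size_XsubC size_mxminpoly.
by rewrite -mxminpoly_linear_is_scalar -ltnNge in Wns.
Qed.

(** The equation reads W ((1 + r) - W) = r for W = V L. *)
Lemma left_inverse_quadratic (F : fieldType) (n : nat) (V L : 'M[F]_n) (r : F) :
    L \in unitmx -> r != 0 -> (V *m L - 1%:M) *m (V *m L - r%:M) = 0 ->
  invmx L = ((1 + 1 / r)%:M - (1 / r) *: (V *m L)) *m V.
Proof.
move=> uL r0 W0; set W := V *m L in W0 *.
suff VL : ((1 + 1 / r)%:M - (1 / r) *: W) *m V *m L = 1%:M.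
  by rewrite -[RHS](mulmxK uL) VL mul1mx.
have W2 : W *m W = (1 + r) *: W - r%:M.
  rewrite -[LHS]subr0 -W0 mulmxBl mul1mx mulmxBr mul_mx_scalar.
  by rewrite opprB opprB addrC addrA subrK addrAC scalerDl scale1r.
rewrite -mulmxA -/W mulmxBl mul_scalar_mx -scalemxAl W2 scalerBr scalerA.
rewrite opprB addrCA -scalerBl scale_scalar_mx.
have -> : 1 + 1 / r - 1 / r * (1 + r) = 0 by field.
by rewrite scale0r addr0 div1r mulVf.
Qed.

(** * The optimal weights *)

Section Weights.
Variables (R : realType) (m : nat).

Let psi (i : nat) : R := pi * i%:R / (2 * m + 1)%N%:R.

Let alpha_optE i : alpha_opt R m i = (1 - cos (psi i + psi i))^-1.
Proof. by rewrite /alpha_opt /psi -mulrDl -mulr2n -mulrnAl mulr_natl. Qed.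

(* The index 0 is included: besides the weights being distinct, this yields
   1 - cos(2 psi_i) <> 0 for i > 0. *)
Let cos_psi_inj i j : (i <= m)%N -> (j <= m)%N ->
  cos (psi i + psi i) = cos (psi j + psi j) -> i = j.
Proof.
have npos : 0 < (2 * m + 1)%N%:R :> R by rewrite ltr0n addn1.
have dom k : (k <= m)%N -> psi k + psi k \in `[0, pi].
  move=> km; have -> : psi k + psi k = pi * ((2 * k)%N%:R / (2 * m + 1)%N%:R).
    by rewrite /psi natrM; ring.
  rewrite in_itv /= mulr_ge0 ?pi_ge0 ?divr_ge0 //=.
  rewrite ler_piMr ?pi_ge0 // ler_pdivrMr // mul1r ler_nat; lia.
move=> im jm /(cos_inj (dom _ im) (dom _ jm)); rewrite /psi => E.
have {}E : pi * i%:R / (2 * m + 1)%N%:R = pi * j%:R / (2 * m + 1)%N%:R :> R by lra.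
have := divIf (lt0r_neq0 npos) E => /(mulfI (lt0r_neq0 (pi_gt0 R))).
by move/eqP; rewrite eqr_nat => /eqP.
Qed.

(* (2m+1) psi_i = i pi, and sin psi_i <> 0. *)
Let oddangle_root i : (1 <= i <= m)%N ->
  (oddangle (1 - cos (psi i + psi i)) m).1 = 0.
Proof.
case/andP => i1 im; have [sinE _] := oddangle_trig (psi i) m.
have n0 : (2 * m + 1)%N%:R != 0 :> R by rewrite pnatr_eq0 addn1.
have : sin (psi i *+ m.*2.+1) = 0.
  have -> : psi i *+ m.*2.+1 = pi *+ i.
    have -> : m.*2.+1 = (2 * m + 1)%N by lia.
    by rewrite -mulr_natr /psi divfK // mulr_natr.
  by elim: (i) => [|l IH]; rewrite ?sin0 // mulrSr sinDpi IH oppr0.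
rewrite sinE => /eqP; rewrite mulf_eq0 => /orP [/eqP s0|/eqP //].
have : cos (psi i + psi i) = cos (psi 0 + psi 0).
  rewrite cosD -!expr2 (_ : psi 0 = 0) ?addr0 ?cos0; last first.
    by rewrite /psi mulr0 mul0r.
  by rewrite -(cos2Dsin2 (psi i)) s0 expr0n /= subr0 addr0.
by move/cos_psi_inj => /(_ im (leq0n _)) i0; rewrite i0 in i1.
Qed.

(** The inverse weights are the m roots of a_m, and a_m(0) = 2m+1. *)
Lemma smoothing_polynomial :
  (oddangle ('X : {poly R[i]}) m).1 = (2 * m + 1)%N%:R *:
    \prod_(a <- [seq a%:C | a <- alphas_opt R m]) (1 - a *: 'X).
Proof.
have in_range i : i \in iota 1 m -> (1 <= i <= m)%N.
  by rewrite mem_iota add1n ltnS.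
rewrite [LHS](@poly_prod_inv_roots _ _ [seq a%:C | a <- alphas_opt R m]).
- by rewrite horner_oddangle oddangle_at0 /= -mul2n addn1.
- rewrite !size_map size_iota; exact: (size_oddangle _ m).1.
- rewrite map_inj_uniq; last exact: complexI.
  rewrite map_inj_in_uniq ?iota_uniq // => i j.
  move=> /in_range/andP[_ im] /in_range/andP[_ jm].
  by rewrite !alpha_optE => /invr_inj /(@addrI _ _) /oppr_inj /cos_psi_inj; apply.
- apply/negP => /mapP [_ /mapP [i /in_range /andP [i1 im] ->]].
  move/esym/eqP; rewrite fmorph_eq0 alpha_optE invr_eq0 subr_eq0 => /eqP c1.
  have : cos (psi i + psi i) = cos (psi 0 + psi 0).
    by rewrite -c1 (_ : psi 0 = 0) ?addr0 ?cos0 // /psi mulr0 mul0r.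
  by move/cos_psi_inj => /(_ im (leq0n _)) i0; rewrite i0 in i1.
- move=> _ /mapP [_ /mapP [i /in_range ir ->] ->].
  rewrite rootE horner_oddangle -fmorphV rmorph_oddangle /= alpha_optE invrK.
  by rewrite oddangle_root.
Qed.

End Weights.

Theorem mainTheorem2 (R : realType) (p n m : nat)
    (A : 'M[R[i]]_p.+1) (B : 'M[R[i]]_(p.+1, n.+1))
    (C : 'M[R[i]]_(n.+1, p.+1)) (D : 'M[R[i]]_n.+1)
    (m_ge1 : (1 <= m)%N)
    (L_unit : block_mx A B C D \in unitmx)
    (A_unit : A \in unitmx)
    (D_unit : D \in unitmx)
    (T_diag : diagonalizable (invmx A *m B *m invmx D *m C)) :
  let L := block_mx A B C D in
  let Minv := vcyclemx A B C D [seq a%:C | a <- alphas_opt R m] in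
  let rho : R[i] := (rho_opt R m)%:C in
  [/\ mxminpoly (Minv *m L) = ('X - 1%:P) * ('X - rho%:P),
      (Minv *m L - 1%:M) *m (Minv *m L - rho%:M) = 0
    & invmx L = ((1 + 1 / rho)%:M - (1 / rho) *: (Minv *m L)) *m Minv].
Proof.
move=> L Minv rho.
have nz k : k.+1%:R != 0 :> R[i] by rewrite pnatr_eq0.
have c0 : (2 * m + 1)%N%:R != 0 :> R[i] by rewrite addn1.
have rhoE : rho = 1 - ((2 * m + 1)%N%:R ^+ 2)^-1.
  by rewrite /rho /rho_opt rmorphB rmorph1 fmorphV rmorphXn rmorph_nat.
have rho0 : rho != 0.
  rewrite rhoE subr_eq0 eq_sym invr_eq1 -natrX -[1]/(1%:R) eqr_nat.
  by rewrite -[1%N in X in _ != X](exp1n 2) eqn_exp2r //; lia.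
have [W0 Wns] : (Minv *m L - 1%:M) *m (Minv *m L - rho%:M) = 0
    /\ ~~ is_scalar_mx (Minv *m L).
  rewrite rhoE.
  have a_mE := smoothing_polynomial R m.
  exact: two_level_minpoly (nz 1%N) A_unit D_unit L_unit a_mE c0.
split => //; first exact: mxminpoly_quadratic.
exact: left_inverse_quadratic.
Qed.
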